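(* Let $f:\mathbb{R}^d\times\mathbb{R}\to\mathbb{R}$ satisfy, for all $x\in\mathbb{R}^d$ and $t\ge0$, $$\|\nabla_{xx}f(x;t)\|\le L_1,\qquad\|\nabla_{tx}f(x;t)\|\le L_2,\qquad\nabla_{xx}f(x;t)\succeq m\mathrm{I},$$ with $m>0$. Suppose there is a function $\mathscr{G}:\mathbb{R}\to\mathbb{R}$ such that $\bar f(x;t):=f(x;t)-\mathscr{G}(t)$ is twice differentiable in $t$ for every $x\in\mathbb{R}^d$ and, for all $x\in\mathbb{R}^d$ and $t\ge0$, $|\nabla_t\bar f(x;t)|\le G_2$ and $|\nabla_{tt}\bar f(x;t)|\le L_3$. Assume also that $\nabla_x f(x;t)$ is continuously differentiable in terms of $x$ and $t$. Define $$\check f(x;t):=\bar f(x;t)-\int_0^t\nabla_t\bar f(y;\tau)\big|_{y=x^\ast(\tau)}\,\mathrm{d}\tau.$$ Then $\nabla_x\check f$ is continuously differentiable in terms of $x$ and $t$; $\check f$ satisfies $\|\nabla_{xx}\check f(x;t)\|\le L_1$, $\|\nabla_{tx}\check f(x;t)\|\le L_2$ and $\nabla_{xx}\check f(x;t)\succeq m\mathrm{I}$ for all $x\in\mathbb{R}^d$, $t\ge0$; and $\check f(x;\cdot)$ is twice differentiable for every $x\in\mathbb{R}^d$, with, for all $x\in\mathbb{R}^d$ and $t\ge0$, $$|\nabla_t\check f(x;t)|\le2G_2,\qquad|\nabla_{tt}\check f(x;t)|\le2L_3+\frac{L_2^2}{m},\qquad|\nabla_t\check f(x;t)|-\frac{L_2}{m}\|\nabla_x\check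 f(x;t)\|\le0.$$
   Context: $x^\ast(t)$ denotes the (unique) minimizer of $f(\cdot;t)$ over $\mathbb{R}^d$. $\nabla_x$ is the gradient in $x$, $\nabla_t$ the derivative in $t$, $\nabla_{ba}f:=\nabla_b(\nabla_a f)$ for $a,b\in\{x,t\}$ (so $\nabla_{xx}$ is the Hessian and $\nabla_{tx}f$ is the $t$-derivative of $\nabla_x f$). $\nabla_t\bar f(y;\tau)|_{y=x^\ast(\tau)}$ is the partial derivative in the time argument at time $\tau$, evaluated at the point $y=x^\ast(\tau)$. $\|\cdot\|$ is the Euclidean norm for vectors and the operator norm for matrices; $\mathrm{I}$ is the identity matrix and $\succeq$ the Loewner order.
   Formalization: Twice differentiability of f̌(x;·), and its t-derivatives, are taken on t ≥ 0 only (right derivative at t = 0), since for t < 0 the minimizer x*(t) or the integral defining f̌ need not exist under the stated hypotheses. *)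

(* Defs.v *)
From HB Require Import structures.
From mathcomp Require Import all_boot all_order all_algebra.
From mathcomp Require Import all_classical all_reals all_analysis.

Set Implicit Arguments.
Unset Strict Implicit.
Unset Printing Implicit Defensive.

Import Order.TTheory GRing.Theory Num.Theory.
Import numFieldNormedType.Exports.

Local Open Scope classical_set_scope.
Local Open Scope ring_scope.

Section Euclidean.
Context {R : realType} {d : nat}.
Implicit Types (v : 'rV[R]_d) (A B : 'M[R]_d).

(* The library norm `|v| on 'rV[R]_d is the max norm; it is equivalent to the
   Euclidean one, so it gives the same topology and differentials. *)
Definition enorm v : R := Num.sqrt (\sum_(i < d) v 0 i ^+ 2).

(* Matrices act on row vectors from the right, as for 'J; transposition does
   not change the value. *)
Definition opnorm A : R :=
  sup [set enorm (v *m A) | v in [set v | enorm v <= 1]].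

Definition loewner_le A B : Prop :=
  (B - A)^T = B - A /\ forall v, 0 <= (v *m (B - A) *m v^T) 0 0.

Definition grad (g : 'rV[R]_d -> R) (x : 'rV[R]_d) : 'rV[R]_d :=
  \row_(i < d) 'D_(delta_mx 0 i) g x.

Definition hess (g : 'rV[R]_d -> R) (x : 'rV[R]_d) : 'M[R]_d := 'J (grad g) x.

End Euclidean.

(* In finite dimension, continuity of p |-> 'd F p v for every v is continuity
   of p |-> 'd F p in operator norm. *)
Definition continuously_differentiable {R : realType} {V W : normedModType R}
    (F : V -> W) : Prop :=
  (forall p, differentiable F p) /\ (forall v, continuous (fun p => 'd F p v)).

Section TimeVarying.
Context {R : realType} {d : nat}.
Implicit Types (f : 'rV[R]_d -> R -> R).

Definition grad_x f (x : 'rV[R]_d) (t : R) : 'rV[R]_d := grad (f ^~ t) x.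

Definition hess_xx f (x : 'rV[R]_d) (t : R) : 'M[R]_d := hess (f ^~ t) x.

Definition grad_tx f (x : 'rV[R]_d) (t : R) : 'rV[R]_d :=
  derive1 (grad_x f x) t.

(* grad_x is a total operator, also where f(.;t) is not differentiable; hence
   the first conjunct. *)
Definition C1_grad_x f : Prop :=
  (forall (x : 'rV[R]_d) (t : R), differentiable (f ^~ t) x) /\
  continuously_differentiable
    (fun p : 'rV[R]_d * R => grad_x f p.1 p.2 : 'rV[R]_d).

(* The value is 0 if f(.;t) has no minimizer. *)
Definition minimizer f (t : R) : 'rV[R]_d :=
  xget 0 [set x | forall y, f x t <= f y t].

Definition fbar f (G : R -> R) (x : 'rV[R]_d) (t : R) : R := f x t - G t.

(* This is meaningful for t >= 0 only, where the minimizer exists; for t < 0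
   the domain of integration is empty. *)
Definition fcheck f (G : R -> R) (x : 'rV[R]_d) (t : R) : R :=
  fbar f G x t -
  \int[lebesgue_measure]_(tau in `[0, t])
    derive1 (fbar f G (minimizer f tau)) tau.

End TimeVarying.

Section HalfLine.
Context {R : realType}.
Implicit Types (g : R -> R) (t : R).

(* Differentiation of functions on [0, +oo[ : the increments h are restricted
   by 0 <= t + h, so this is the ordinary derivative at t > 0 and the right
   derivative at t = 0. *)
Definition hl_quot g t (h : R) : R := h^-1 * (g (t + h) - g t).

Definition hl_derivable g t : Prop :=
  cvg (hl_quot g t @ within [set h | 0 <= t + h] (0 : R)^').

Definition hl_derive g t : R :=
  lim (hl_quot g t @ within [set h | 0 <= t + h] (0 : R)^').

End HalfLine.

(* Main.v *)
(* Only a function of t is subtracted from f, so all x-derivatives are those of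
   f, and everything reduces to g(t) := (d/dt fbar)(xs(t); t) where xs(t) is the
   minimizer. Strong convexity gives m |y - xs(t)| <= |grad f(y; t)|; since
   grad f(xs(t); .) is L2-Lipschitz, xs is (L2 / m)-Lipschitz on [0, +oo[, and
   expanding 0 = grad f(xs(t + h); t + h) to first order shows that xs is
   differentiable there. The x-derivative of d/dt fbar is the mixed derivative
   of f: a second difference of f is evaluated by two mean value theorems. Hence
   g is differentiable with |g'| <= L3 + L2 (L2 / m), it is continuous, and the
   derivative of fcheck(x; .) is (d/dt fbar)(x; t) - g(t), which is at most
   L2 |x - xs(t)| in absolute value. *)
Require Import Defs.
From HB Require Import structures.
From mathcomp Require Import all_boot all_order all_algebra.
From mathcomp Require Import lra.
From mathcomp Require Import all_classical all_reals all_analysis.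

Import Order.TTheory GRing.Theory Num.Theory.
Import numFieldNormedType.Exports.

Set Implicit Arguments.
Unset Strict Implicit.
Unset Printing Implicit Defensive.

Local Open Scope classical_set_scope.
Local Open Scope ring_scope.

(** * Euclidean inner product, Cauchy-Schwarz, comparison with the max norm *)

Section DotProduct.
Context {R : realType} {d : nat}.
Implicit Types (u v w : 'rV[R]_d).

Definition dotv u v : R := \sum_(i < d) u 0 i * v 0 i.

Lemma dotvE u v : dotv u v = (u *m v^T) 0 0.
Proof. by rewrite mxE; apply: eq_bigr => i _; rewrite mxE. Qed.

Lemma dotvC u v : dotv u v = dotv v u.
Proof. by apply: eq_bigr => i _; rewrite mulrC. Qed.

Lemma dotvDl u v w : dotv (u + v) w = dotv u w + dotv v w.
Proof. by rewrite !dotvE mulmxDl mxE. Qed.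

Lemma dotvNl u w : dotv (- u) w = - dotv u w.
Proof. by rewrite !dotvE mulNmx mxE. Qed.

Lemma dotvBl u v w : dotv (u - v) w = dotv u w - dotv v w.
Proof. by rewrite dotvDl dotvNl. Qed.

Lemma dotvZl k u w : dotv (k *: u) w = k * dotv u w.
Proof. by rewrite !dotvE -scalemxAl mxE. Qed.

Lemma dotvZr k u w : dotv u (k *: w) = k * dotv u w.
Proof. by rewrite dotvC dotvZl dotvC. Qed.

Lemma dot0v w : dotv 0 w = 0.
Proof. by rewrite dotvE mul0mx mxE. Qed.

Lemma dotvv_ge0 v : 0 <= dotv v v.
Proof. by apply: sumr_ge0 => i _; rewrite -expr2 sqr_ge0. Qed.

Lemma dotvv_enorm v : dotv v v = enorm v ^+ 2.
Proof.
by rewrite sqr_sqrtr; [|apply: sumr_ge0 => i _; exact: sqr_ge0].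
Qed.

Lemma enorm_ge0 v : 0 <= enorm v. Proof. exact: sqrtr_ge0. Qed.

Lemma enormE v : enorm v = Num.sqrt (dotv v v).
Proof. by rewrite dotvv_enorm sqrtr_sqr ger0_norm ?enorm_ge0. Qed.

(** Carries Euclidean bounds over to the max norm, in which limits are taken; [cvg_enorm] is the way
    back. *)
Lemma norm_le_enorm v : `|v| <= enorm v.
Proof.
rewrite [leLHS]/Num.Def.normr/= mx_normrE bigmax_le ?enorm_ge0// => -[i j] _ /=.
rewrite ord1 -sqrtr_sqr ler_wsqrtr// (bigD1 j)//= lerDl.
by apply: sumr_ge0 => k _; exact: sqr_ge0.
Qed.

Lemma enorm0 : enorm (0 : 'rV[R]_d) = 0.
Proof. by rewrite enormE dot0v sqrtr0. Qed.

Lemma enorm0_eq0 v : enorm v = 0 -> v = 0.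
Proof.
by move=> v0; apply/normr0_eq0/le_anti; rewrite normr_ge0 -v0 norm_le_enorm.
Qed.

Lemma enormZ k v : enorm (k *: v) = `|k| * enorm v.
Proof.
rewrite enormE dotvZl dotvZr mulrA -expr2 sqrtrM ?sqr_ge0//.
by rewrite sqrtr_sqr -enormE.
Qed.

Lemma enormN v : enorm (- v) = enorm v.
Proof. by rewrite -scaleN1r enormZ normrN1 mul1r. Qed.

Lemma normr_dotv_le u v : `|dotv u v| <= enorm u * enorm v.
Proof.
have [v0|v0] := eqVneq (enorm v) 0.
  by rewrite (enorm0_eq0 v0) dotvC dot0v normr0 mulr_ge0 ?enorm_ge0.
rewrite -(@ler_pXn2r _ 2) ?nnegrE ?mulr_ge0 ?enorm_ge0//.
rewrite real_normK ?num_real// exprMn -!dotvv_enorm.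
set B := dotv v v; set C := dotv u v.
have B0 : 0 < B by rewrite /B dotvv_enorm exprn_gt0// lt_def v0 enorm_ge0.
(* Expanding this square gives [B (B |u|^2 - C^2) >= 0], and [B > 0] cancels. *)
have := dotvv_ge0 (B *: u - C *: v).
rewrite dotvBl !dotvZl ![dotv _ (_ - _)]dotvC !dotvBl !dotvZl.
rewrite (dotvC v u) -/B -/C => h.
by rewrite -subr_ge0 -(pmulr_rge0 _ B0); apply: le_trans h _; lra.
Qed.

(** Cauchy-Schwarz, then one factor [enorm v] cancels; it turns bounds on quadratic forms into
    bounds on norms. *)
Lemma enorm_le_of_dotv k u v :
  k * dotv v v <= dotv u v -> k * enorm v <= enorm u.
Proof.
rewrite dotvv_enorm => h.
have [->|v0] := eqVneq (enorm v) 0; first by rewrite mulr0 enorm_ge0.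
have {}v0 : 0 < enorm v by rewrite lt_def v0 enorm_ge0.
rewrite -(ler_pM2r v0) -mulrA -expr2; apply: le_trans h _.
exact: le_trans (ler_norm _) (normr_dotv_le _ _).
Qed.

Lemma cvg_dotv {T : Type} (E : set_system T) {FE : Filter E}
    (a b : T -> 'rV[R]_d) u v :
  a @ E --> u -> b @ E --> v -> (fun x => dotv (a x) (b x)) @ E --> dotv u v.
Proof.
move=> au bv; apply: cvg_big => [|i _]; first exact: add_continuous.
apply: cvgM.
- exact: (cvg_comp _ _ au (@coord_continuous _ _ _ 0 i u)).
- exact: (cvg_comp _ _ bv (@coord_continuous _ _ _ 0 i v)).
Qed.

Lemma cvg_enorm {T : Type} (E : set_system T) {FE : Filter E}
    (a : T -> 'rV[R]_d) u :
  a @ E --> u -> (fun x => enorm (a x)) @ E --> enorm u.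
Proof.
move=> au; rewrite (_ : enorm u = Num.sqrt (dotv u u)) ?enormE//.
under eq_fun do rewrite enormE.
exact: (cvg_comp _ _ (cvg_dotv au au) (@sqrt_continuous _ _)).
Qed.

Lemma is_derive_dotv (V : normedModType R) (a : V -> 'rV[R]_d)
    (x e : V) da w :
  is_derive x e a da ->
  is_derive x e (fun y => dotv (a y) w) (dotv da w).
Proof.
move=> [ad aE].
suff : (fun h => dotv (h^-1 *: ((a \o shift x) (h *: e) - a x)) w) @ 0^'
    --> dotv da w.
  under eq_fun do rewrite dotvZl dotvBl.
  move=> cv.
  by split; [apply/cvg_ex; exists (dotv da w)|apply/cvg_lim].
by apply: cvg_dotv; [rewrite -aE; exact: ad|exact: cvg_cst].
Qed.

End DotProduct.

(** * Derivatives along lines and the mean value theorem *)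

Section Calculus.

Lemma is_derive_line (R : numFieldType) (V W : normedModType R) (F : V -> W)
    (p u : V) (s : R) :
  differentiable F (p + s *: u) ->
  is_derive s 1 (fun s => F (p + s *: u)) ('d F (p + s *: u) u).
Proof.
move=> dF.
have E : (fun h : R => h^-1 *: (((fun s => F (p + s *: u)) \o shift s) (h *: 1)
    - F (p + s *: u))) = fun h : R => h^-1 *:
      ((F \o shift (p + s *: u)) (h *: u) - F (p + s *: u)).
  apply/funext => h /=; congr (_ *: (F _ - _)).
  by rewrite [h *: 1]mulr1 scalerDl addrCA.
have cF : derivable F (p + s *: u) u by exact: diff_derivable.
split; first by rewrite /derivable E.
by rewrite /derive E -deriveE.
Qed.

Lemma MVT_is_derive (R : realType) (g dg : R -> R) (a b : R) : a <= b ->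
  (forall s : R, is_derive s 1 g (dg s)) ->
  exists2 c, a <= c <= b & g b - g a = dg c * (b - a).
Proof.
move=> ab dgP.
have gc : {within `[a, b], continuous g}.
  apply: continuous_subspaceT => s.
  by apply/differentiable_continuous/derivable1_diffP; case: (dgP s).
have [c + ->] := MVT_segment ab (fun s _ => dgP s) gc.
by rewrite in_itv/= => cab; exists c.
Qed.

End Calculus.

(** * Strongly convex functions: monotone gradient, existence of a minimizer *)

Section StronglyConvex.
Context {R : realType} {d : nat}.
Implicit Types (x y v : 'rV[R]_d).
Variables (g : 'rV[R]_d -> R) (m : R).
Hypothesis m_gt0 : 0 < m.
Hypothesis g_diff : forall x, differentiable g x.
Hypothesis grad_diff : forall x, differentiable (grad g) x.
Hypothesis hess_ge : forall x, loewner_le m%:M (hess g x).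

Lemma is_derive_dir x v (s : R) :
  is_derive s 1 (fun s => g (x + s *: v)) (dotv (grad g (x + s *: v)) v).
Proof.
apply: (is_derive_eq (is_derive_line (g_diff _))).
rewrite [v in 'd g _ v]row_sum_delta linear_sum; apply: eq_bigr => i _.
by rewrite linearZ mxE -deriveE// mulrC.
Qed.

Lemma is_derive_grad_dir x v w (s : R) :
  is_derive s 1 (fun s => dotv (grad g (x + s *: v)) w)
    (dotv (v *m hess g (x + s *: v)) w).
Proof.
apply: is_derive_dotv; apply: (is_derive_eq (is_derive_line (grad_diff _))).
by rewrite -deriveE// deriveEjacobian.
Qed.

Lemma hess_dotv_ge x v : m * dotv v v <= dotv (v *m hess g x) v.
Proof.
have [_ /(_ v)] := hess_ge x.
by rewrite mulmxBr mul_mx_scalar -dotvE dotvBl dotvZl subr_ge0.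
Qed.

Lemma hess_enorm_ge x v : m * enorm v <= enorm (v *m hess g x).
Proof. exact/enorm_le_of_dotv/hess_dotv_ge. Qed.

(** Along the segment, the pairing of the gradient with [v] has derivative at least [m |v|^2] by the
    Hessian bound. *)
Lemma grad_monotone x v : m * dotv v v <= dotv (grad g (x + v) - grad g x) v.
Proof.
have [c _] := MVT_is_derive ler01 (is_derive_grad_dir x v v).
rewrite subr0 mulr1 scale1r scale0r addr0 -dotvBl => ->.
exact: hess_dotv_ge. Qed.

Lemma enorm_le_grad x y : m * enorm (y - x) <= enorm (grad g y - grad g x).
Proof.
apply: enorm_le_of_dotv; rewrite -[in grad g y](subrKC x y).
exact: grad_monotone.
Qed.

Lemma dotv_grad_le x v (s : R) : 0 <= s ->
  dotv (grad g x) v + m * s * dotv v v <= dotv (grad g (x + s *: v)) v.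
Proof.
rewrite le_eqVlt => /predU1P[<-|s0].
  by rewrite mulr0 mul0r scale0r !addr0.
have := grad_monotone x (s *: v).
rewrite !dotvZl !dotvZr dotvBl -subr_ge0 => h.
by rewrite -subr_ge0 -(pmulr_rge0 _ s0); apply: le_trans h _; lra.
Qed.

(* The constant m / 4 instead of the optimal m / 2 avoids integration; only
   coercivity is needed. *)
Lemma strong_convexity x v :
  g x + dotv (grad g x) v + m / 4 * dotv v v <= g (x + v).
Proof.
(* With [a] the slope at 0, the slope is at least [a] on the first half of the segment and at least
   [a + m / 2 |v|^2] on the second; the average gives [m / 4]. *)
have [|c /andP[c0 _]] := @MVT_is_derive R _ _ 0 2^-1 _ (is_derive_dir x v).
  by rewrite invr_ge0.
have [|e /andP[e0 _]] := @MVT_is_derive R _ _ 2^-1 1 _ (is_derive_dir x v).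
  by lra.
rewrite !scale1r !scale0r !addr0 => E1 E2.
have v0 := dotvv_ge0 v.
have := dotv_grad_le x v c0.
have := dotv_grad_le x v (le_trans _ e0).
set a := dotv (grad g x) v in E1 E2 *.
have : m * 2^-1 * dotv v v <= m * e * dotv v v.
  by rewrite ler_wpM2r// ler_wpM2l// ltW.
have : 0 <= m * c * dotv v v by rewrite !mulr_ge0// ltW.
rewrite invr_ge0 ler0n => h1 h2 /(_ isT) h3 h4.
by lra.
Qed.

Lemma exists_minimizer : exists x, forall y, g x <= g y.
Proof.
(* Beyond this radius the quadratic term of [strong_convexity] at 0 dominates the linear one, so
   [g y >= g 0]. Hence a minimum over the compact ball, which contains 0, is global. *)
pose r := 4 * enorm (grad g 0) / m.
have r0 : 0 <= r by rewrite /r !mulr_ge0 ?enorm_ge0// invr_ge0 ltW.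
pose A := [set x : 'rV[R]_d | `|x| <= r].
have [|||c] := @EVT_min_rV R d g A.
- by exists 0; rewrite /A/= normr0.
- apply: bounded_closed_compact.
    exists r; split; first exact: num_real.
    by move=> x rx y /le_trans; apply; exact: ltW.
  apply: (@closed_comp _ _ (fun x : 'rV[R]_d => `|x|) [set z | z <= r]).
    by move=> x _; exact: norm_continuous.
  exact: closed_le.
- by apply: continuous_subspaceT => x; exact: differentiable_continuous.
rewrite inE => cA cmin; exists c => y.
have [yr|yr] := leP `|y| r; first by apply: cmin; rewrite inE.
apply: (@le_trans _ _ (g 0)); first by apply: cmin; rewrite inE /A/= normr0.
have := strong_convexity 0 y; rewrite add0r; apply: le_trans.
rewrite -addrA lerDl dotvv_enorm.
have ry := lt_le_trans yr (norm_le_enorm y).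
have := normr_dotv_le (grad g 0) y; rewrite ler_norml => /andP[+ _].
suff : 0 <= (m / 4 * enorm y - enorm (grad g 0)) * enorm y by lra.
rewrite mulr_ge0 ?enorm_ge0// subr_ge0 mulrAC ler_pdivlMr// mulrC.
by move: ry; rewrite /r ltr_pdivrMr// mulrC; lra.
Qed.

Lemma grad_minimizer x : (forall y, g x <= g y) -> grad g x = 0.
Proof.
move=> xmin; apply: enorm0_eq0; apply/eqP.
rewrite -sqrf_eq0 -dotvv_enorm; apply/eqP; set v := grad g x.
(* In the direction of the gradient itself the slope at 0 is [|v|^2], and it vanishes at an interior
   minimum. *)
have D := is_derive_dir x v 0.
have Z : is_derive (0 : R) (1 : R) (fun s : R => g (x + s *: v)) 0.
  apply: (@derive1_at_min R _ (-1) 1); rewrite ?in_itv/= ?ltrN10 ?ltr01//.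
  - by move=> s _; case: (is_derive_dir x v s).
  - by move=> s _; rewrite scale0r addr0; exact: xmin.
move: (@derive_val _ _ _ _ _ _ _ D).
by rewrite (@derive_val _ _ _ _ _ _ _ Z) scale0r addr0 => <-.
Qed.

End StronglyConvex.

(** * Space and time derivatives of the gradient *)

Section MixedDerivatives.
Context {R : realType} {d : nat}.
Variables (f : 'rV[R]_d -> R -> R).
Hypothesis f_C1 : C1_grad_x f.
Implicit Types (x v a : 'rV[R]_d) (t s : R).

Let F (p : 'rV[R]_d * R) : 'rV[R]_d := grad_x f p.1 p.2.

Let F_diff p : differentiable F p.
Proof. by case: f_C1 => _ [+ _]; exact. Qed.

Lemma differentiable_grad_x x t : differentiable (grad (f ^~ t)) x.
Proof.
rewrite (_ : grad (f ^~ t) = F \o (fun y => (y, t)))//.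
by apply: differentiable_comp; [exact: differentiable_pair|exact: F_diff].
Qed.

Lemma mulmx_hess_xx x t v : v *m hess_xx f x t = 'd F (x, t) (v, 0).
Proof.
rewrite /hess_xx /hess -deriveEjacobian; last exact: differentiable_grad_x.
rewrite deriveE; last exact: differentiable_grad_x.
rewrite (_ : grad (f ^~ t) = F \o (fun y => (y, t)))// diff_comp//=.
by rewrite diff_val.
Qed.

Lemma is_derive_grad_x_diff x t :
  is_derive t 1 (grad_x f x) ('d F (x, t) (0, 1)).
Proof.
have E s : ((x, 0) : 'rV[R]_d * R) + s *: ((0, 1) : 'rV[R]_d * R) = (x, s).
by congr pair => /=; rewrite ?scaler0 ?addr0// add0r [s *: 1]mulr1.
have := @is_derive_line _ _ _ F (x, 0) (0, 1) t (F_diff _).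
rewrite E => h; rewrite (_ : grad_x f x = fun s => F ((x, 0) + s *: (0, 1)))//.
by apply/funext => s; rewrite E.
Qed.

Lemma grad_txE x t : grad_tx f x t = 'd F (x, t) (0, 1).
Proof.
rewrite /grad_tx derive1E.
by have /@derive_val -> := is_derive_grad_x_diff x t.
Qed.

Lemma is_derive_grad_x x t : is_derive t 1 (grad_x f x) (grad_tx f x t).
Proof. by rewrite grad_txE; exact: is_derive_grad_x_diff. Qed.

Lemma grad_tx_continuous : continuous (fun p => grad_tx f p.1 p.2).
Proof.
rewrite (_ : (fun p => _) = fun p => 'd F p (0, 1)).
  by case: f_C1 => _ [_]; exact.
by apply/funext => -[x t]; rewrite grad_txE.
Qed.

(** Serves to compare the mixed derivative at an intermediate point of the mean value theorem with
    its value at the minimizer. *)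
Lemma near_grad_tx x t e : 0 < e ->
  \forall p \near (x, t), enorm (grad_tx f p.1 p.2 - grad_tx f x t) <= e.
Proof.
move=> e0.
have gc : (fun p : 'rV[R]_d * R => grad_tx f p.1 p.2) @ nbhs (x, t)
    --> grad_tx f x t by exact (@grad_tx_continuous (x, t)).
have : (fun p : 'rV[R]_d * R => enorm (grad_tx f p.1 p.2 - grad_tx f x t))
    @ nbhs (x, t) --> enorm (0 : 'rV[R]_d).
  apply: cvg_enorm; rewrite -(subrr (grad_tx f x t)).
  by have := @cvgB R _ _ _ _ _ _ _ _ gc (cvg_cst _); apply.
by move=> /cvgr_le; apply; rewrite enorm0.
Qed.

Lemma grad_x_diffE x t v s :
  'd F (x, t) (v, s) = v *m hess_xx f x t + s *: grad_tx f x t.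
Proof.
rewrite mulmx_hess_xx grad_txE -linearZ -linearD; congr ('d F _ _).
by congr pair => /=; rewrite ?scaler0 ?addr0// add0r [s *: 1]mulr1.
Qed.

(** Joint differentiability, with the differential split into its two partial parts; to be applied
    along the path of minimizers. *)
Lemma grad_x_expansion x t e : 0 < e ->
  \forall p \near (0 : 'rV[R]_d * R),
    `|grad_x f (x + p.1) (t + p.2) - grad_x f x t
      - (p.1 *m hess_xx f x t + p.2 *: grad_tx f x t)| <= e * `|p|.
Proof.
move=> e0; have /diff_locally/eqaddoP/(_ _ e0) := F_diff (x, t).
apply: filterS => -[v s].
rewrite -grad_x_diffE -addrA -opprD [x + _]addrC [t + _]addrC.
exact.
Qed.

(* The mean value theorem in space, then in time. *)
Lemma second_difference x v t s : 0 <= s ->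
  exists sg ta, [/\ 0 <= sg <= 1, t <= ta <= t + s &
    (f (x + v) (t + s) - f x (t + s)) - (f (x + v) t - f x t) =
    s * dotv (grad_tx f (x + sg *: v) ta) v].
Proof.
move=> s0; have [f_diff _] := f_C1.
have D (r : R) : is_derive r 1
    (fun r : R => f (x + r *: v) (t + s) - f (x + r *: v) t)
    (dotv (grad_x f (x + r *: v) (t + s)) v - dotv (grad_x f (x + r *: v) t) v).
  by apply: is_deriveB; exact: (is_derive_dir (f_diff ^~ _)).
have [sg sg01] := MVT_is_derive ler01 D.
rewrite !scale1r !scale0r !addr0 subr0 mulr1 => E.
have D' (r : R) := is_derive_dotv v (is_derive_grad_x (x + sg *: v) r).
have [|ta tab E'] := @MVT_is_derive R _ _ t (t + s) _ D'.
  by rewrite lerDl.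
exists sg, ta; split => //.
by rewrite mulrC -(addrK t s) [in RHS](addrC s) addrK -E' -E; lra.
Qed.

End MixedDerivatives.

(** * Spatial increments of the time derivative *)

Section MixedTimeDerivative.
Context {R : realType} {d : nat}.
Variables (f : 'rV[R]_d -> R -> R) (G : R -> R).
Hypothesis f_C1 : C1_grad_x f.
Hypothesis fbar_d1 : forall (x : 'rV[R]_d) (t : R), derivable (fbar f G x) t 1.
Implicit Types (x v a : 'rV[R]_d) (t s : R).

(* Divide [second_difference] by [s] and let [s] tend to [0+]. *)
Lemma derive1_fbar_increment x v a t c dl : 0 < dl ->
  (forall sg ta, 0 <= sg <= 1 -> t <= ta < t + dl ->
    `|dotv (grad_tx f (x + sg *: v) ta - a) v| <= c) ->
  `|derive1 (fbar f G (x + v)) t - derive1 (fbar f G x) t - dotv a v| <= c.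
Proof.
move=> dl0 bnd.
pose D s := fbar f G (x + v) s - fbar f G x s.
have DE : 'D_1 D t = derive1 (fbar f G (x + v)) t - derive1 (fbar f G x) t.
  by rewrite !derive1E -deriveB.
have Dd : derivable D t 1 by exact: derivableB.
rewrite -DE.
have cv : (fun h => `|h^-1 *: (D (h *: 1 + t) - D t) - dotv a v|) @ (0 : R)^'+
    --> `|'D_1 D t - dotv a v|.
  apply: cvg_norm; apply: cvgB; last exact: cvg_cst.
  exact: cvg_dnbhs_at_right Dd.
apply: (closed_cvg (fun z => z <= c) _ _ _ cv); first exact: closed_le.
near=> h.
have h0 : 0 < h by [].
have hdl : h < dl by near: h; exact: nbhs_right_lt.
have [sg [ta [sg01 /andP[ta1 ta2] E]]] :=
  @second_difference R d f f_C1 x v t h (ltW h0).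
(* [G] cancels in the spatial difference, which leaves the second difference of [f]. *)
have -> : D (h *: 1 + t) - D t = h * dotv (grad_tx f (x + sg *: v) ta) v.
  rewrite -E [h *: 1]mulr1 /D /fbar (addrC h); lra.
rewrite [_ *: _]mulKf ?gt_eqF// -dotvBl; apply: bnd => //.
by rewrite ta1 (le_lt_trans ta2)// ltrD2l.
Unshelve. all: by end_near. Qed.

End MixedTimeDerivative.

(** * The filter of admissible increments on the half-line *)

Section HalfLineFilter.
Context {R : realType}.
Implicit Types (t l : R) (g : R -> R).

Definition hl_nbhs t : set_system R := within [set h | 0 <= t + h] (0 : R)^'.

#[global] Instance hl_nbhs_filter t : Filter (hl_nbhs t).
Proof. exact: within_filter. Qed.

Lemma near_hl_nbhs t (P : set R) dl : 0 < dl ->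
  (forall h, h != 0 -> `|h| < dl -> 0 <= t + h -> P h) -> hl_nbhs t P.
Proof.
move=> dl0 hP; apply/nbhs_ballP; exists dl => //= h.
by rewrite /ball/= sub0r normrN => hdl h0; exact: hP.
Qed.

(** Small positive increments are admissible even at 0; properness makes limits unique and lets
    bounds pass to them. *)
Lemma hl_nbhs_proper t : 0 <= t -> ProperFilter (hl_nbhs t).
Proof.
move=> t0; apply: Build_ProperFilter_ex => P /nbhs_ballP[dl /= dl0 hP].
have h0 : 0 < dl / 2 by rewrite divr_gt0.
exists (dl / 2); apply: hP; rewrite ?gt_eqF// /ball/= ?addr_ge0 ?(ltW h0)//.
by rewrite sub0r normrN gtr0_norm// ltr_pdivrMr// ltr_pMr// ltr1n.
Qed.

Lemma hl_nbhs_cvg0 t : hl_nbhs t `=>` nbhs (0 : R).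
Proof.
move=> P /nbhs_ballP[dl dl0 hP]; apply: (near_hl_nbhs dl0) => h _ hdl _.
by apply: hP; rewrite /ball/= sub0r normrN.
Qed.

End HalfLineFilter.

(** * The path of minimizers: Lipschitz bound and derivative *)

Section MinimizerPath.
Context {R : realType} {d : nat}.
Variables (f : 'rV[R]_d -> R -> R) (m L2 : R).
Hypothesis m_gt0 : 0 < m.
Hypothesis f_C1 : C1_grad_x f.
Hypothesis f_tx : forall (x : 'rV[R]_d) (t : R),
  0 <= t -> enorm (grad_tx f x t) <= L2.
Hypothesis f_sc : forall (x : 'rV[R]_d) (t : R),
  0 <= t -> loewner_le m%:M (hess_xx f x t).
Implicit Types (x v a : 'rV[R]_d) (t s : R).

Local Notation xs := (minimizer f).

Lemma minimizerP t : 0 <= t -> forall y, f (xs t) t <= f y t.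
Proof.
move=> t0; have [fd _] := f_C1.
apply: (@xgetPex _ 0 [set x | forall y, f x t <= f y t]).
exact: (exists_minimizer m_gt0 (fd ^~ t) (differentiable_grad_x f_C1 ^~ t)
  (fun x => f_sc x t0)).
Qed.

Lemma grad_x_minimizer t : 0 <= t -> grad_x f (xs t) t = 0.
Proof.
move=> t0; have [fd _] := f_C1; apply: (grad_minimizer (fd ^~ t)).
exact: minimizerP.
Qed.

Lemma minimizer_dist x t : 0 <= t ->
  m * enorm (x - xs t) <= enorm (grad_x f x t).
Proof.
move=> t0.
have := enorm_le_grad (differentiable_grad_x f_C1 ^~ t)
  (fun x => f_sc x t0) (xs t) x.
by rewrite -!/(grad_x f _ t) grad_x_minimizer// subr0.
Qed.

Lemma grad_x_lipschitz_time x t t' : 0 <= t -> 0 <= t' ->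
  enorm (grad_x f x t' - grad_x f x t) <= L2 * `|t' - t|.
Proof.
move: t t'; suff h t t' : 0 <= t -> t <= t' ->
    enorm (grad_x f x t' - grad_x f x t) <= L2 * (t' - t).
  move=> t t' t0 t'0; have [tt'|tt'] := leP t t'.
    by rewrite ger0_norm ?subr_ge0// h.
  rewrite distrC gtr0_norm ?subr_gt0//; apply: le_trans (h _ _ t'0 (ltW tt')).
  by rewrite -opprB enormN.
(* The mean value theorem is scalar, so the increment [w] is paired with itself; one factor
   [enorm w] then cancels. *)
move=> t0 tt'; set w := _ - _.
have [c /andP[tc _]] := MVT_is_derive tt'
  (fun s => is_derive_dotv w (is_derive_grad_x f_C1 x s)).
rewrite -dotvBl -/w dotvv_enorm => E.
have [->|w0] := eqVneq (enorm w) 0.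
  rewrite mulr_ge0 ?subr_ge0//.
  exact: le_trans (enorm_ge0 _) (f_tx x t0).
have {}w0 : 0 < enorm w by rewrite lt_def w0 enorm_ge0.
rewrite -(ler_pM2r w0) -expr2 E mulrAC ler_wpM2r ?subr_ge0//.
apply: le_trans (ler_norm _) _; apply: le_trans (normr_dotv_le _ _) _.
by rewrite ler_wpM2r ?enorm_ge0// f_tx// (le_trans t0).
Qed.

(** [minimizer_dist] at time [t'] is applied to [xs t], whose gradient vanishes at time [t]. *)
Lemma minimizer_lipschitz t t' : 0 <= t -> 0 <= t' ->
  enorm (xs t' - xs t) <= L2 / m * `|t' - t|.
Proof.
move=> t0 t'0; rewrite mulrAC ler_pdivlMr// mulrC.
have := minimizer_dist (xs t) t'0; rewrite -opprB enormN.
move=> /le_trans; apply.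
have := grad_x_lipschitz_time (xs t) t0 t'0.
by rewrite (grad_x_minimizer t0) subr0.
Qed.

(** A positive definite form has trivial kernel. *)
Lemma hess_xx_unit x t : 0 <= t -> hess_xx f x t \in unitmx.
Proof.
move=> t0; rewrite -row_free_unit -kermx_eq0; apply/rowV0P => v /sub_kermxP vH.
have := hess_dotv_ge (fun x => f_sc x t0) x v.
rewrite -/(hess_xx f x t) vH dot0v pmulr_rle0// dotvv_enorm => v0.
by apply: enorm0_eq0; apply/eqP; rewrite -sqrf_eq0 eq_le v0 sqr_ge0.
Qed.

(** The formula of the implicit function theorem. The Lipschitz bound, known beforehand, makes the
    remainder of the expansion [o(h)]. *)
Lemma minimizer_derivative t : 0 <= t ->
  (fun h => h^-1 *: (xs (t + h) - xs t)) @ hl_nbhs t -->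
  - grad_tx f (xs t) t *m invmx (hess_xx f (xs t) t).
Proof.
move=> t0; set H := hess_xx f (xs t) t; set a := grad_tx f (xs t) t.
have HU : H \in unitmx by exact: hess_xx_unit.
(* Convergence after multiplication by [H] suffices, since [H] expands Euclidean lengths by at least
   [m]. *)
suff cv : (fun h => (h^-1 *: (xs (t + h) - xs t)) *m H) @ hl_nbhs t --> - a.
  set l := _ *m _; apply/cvgrPdist_le => e e0.
  have /cvgrPdist_le/(_ (m * e)) : (fun h => enorm
      ((h^-1 *: (xs (t + h) - xs t)) *m H + a)) @ hl_nbhs t --> 0.
    rewrite -(@enorm0 R d) -(addNr a); apply: cvg_enorm.
    by apply: cvgD => //; exact: cvg_cst.
  rewrite mulr_gt0// => /(_ isT); apply: filterS => h; set q := _ *: _.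
  rewrite sub0r normrN ger0_norm ?enorm_ge0// => qe.
  rewrite distrC (le_trans (norm_le_enorm _))// -(ler_pM2l m_gt0).
  apply: le_trans qe; rewrite -[a in leRHS]opprK -[- a in leRHS](mulmxKV HU).
  rewrite -mulmxBl.
  exact: hess_enorm_ge (fun x => f_sc x t0) _ _.
(* [K * |h|] bounds both components of the joint increment: [L2 / m] serves for space, 1 for
   time. *)
pose K := Num.max (L2 / m) 1.
apply/cvgrPdist_le => e e0.
have e'0 : 0 < e / K.
  by rewrite divr_gt0// /K lt_max ltr01 orbT.
have /nbhs_ballP[dl /= dl0 near0] := grad_x_expansion f_C1 (xs t) t e'0.
have K1 : 1 <= K by rewrite /K le_max lexx orbT.
have K0 : 0 < K := lt_le_trans ltr01 K1.
apply: (@near_hl_nbhs _ _ _ (dl / K)); first by rewrite divr_gt0.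
move=> h h0; rewrite ltr_pdivlMr// => hdl th0.
have ph : `|((xs (t + h) - xs t, h) : 'rV[R]_d * R)| <= K * `|h|.
  rewrite prod_normE/= ge_max; apply/andP; split.
    apply: le_trans (norm_le_enorm _) _.
    have := minimizer_lipschitz t0 th0; rewrite addrAC subrr add0r.
    move=> /le_trans; apply.
    by rewrite ler_wpM2r// /K le_max lexx.
  by rewrite -[leLHS]mul1r ler_wpM2r.
have := near0 (xs (t + h) - xs t, h).
rewrite -ball_normE /ball_/= sub0r normrN.
move=> /(_ _)/wrap[|]; first by apply: le_lt_trans ph _; rewrite mulrC.
(* Both gradients vanish, so the linear part alone is bounded by the remainder. *)
rewrite subrKC !grad_x_minimizer// subrr sub0r normrN => E.
have {E} := le_trans E (ler_wpM2l (ltW e'0) ph).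
rewrite mulrA divfK ?gt_eqF// -/a -/H => E.
rewrite -[- a](scalerK h0) -scalemxAl -scalerBr normrZ normfV.
rewrite ler_pdivrMl ?normr_gt0// mulrC; apply: le_trans E.
by rewrite scalerN -opprD normrN addrC.
Qed.

End MinimizerPath.

(** * Differentiation and integration on the half-line *)

Section HalfLineCalculus.
Context {R : realType}.
Implicit Types (t l s : R) (g : R -> R).

Lemma hl_derive_cvg g t l : 0 <= t -> hl_quot g t @ hl_nbhs t --> l ->
  hl_derivable g t /\ hl_derive g t = l.
Proof.
move=> t0 gl; have W := hl_nbhs_proper t0.
split; first by apply/cvg_ex; exists l.
exact: cvg_lim gl.
Qed.

Lemma hl_quot_derivable g t : derivable g t 1 ->
  hl_quot g t @ hl_nbhs t --> derive1 g t.
Proof.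
move=> gd; rewrite derive1E.
have E : hl_quot g t = fun h => h^-1 *: ((g \o shift t) (h *: 1) - g t).
  by apply/funext => h; rewrite /hl_quot /= [h *: 1]mulr1 [t + h]addrC.
rewrite E; exact: cvg_within_filter gd.
Qed.

(** Admissible increments stay on the half-line, so a formula valid only there can be substituted
    before differentiating again. *)
Lemma eq_hl_quot_cvg g g' t l : (forall s, 0 <= s -> g s = g' s) -> 0 <= t ->
  hl_quot g t @ hl_nbhs t --> l -> hl_quot g' t @ hl_nbhs t --> l.
Proof.
move=> gg' t0; apply: cvg_trans; apply: near_eq_cvg.
apply: (near_hl_nbhs ltr01) => h _ _ th.
by rewrite /hl_quot !gg'.
Qed.

Lemma hl_quotB g g' t l l' :
  hl_quot g t @ hl_nbhs t --> l -> hl_quot g' t @ hl_nbhs t --> l' ->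
  hl_quot (g \- g') t @ hl_nbhs t --> l - l'.
Proof.
move=> gl gl'.
rewrite (_ : hl_quot (g \- g') t = hl_quot g t \- hl_quot g' t).
  exact: cvgB.
by apply/funext => h; rewrite /hl_quot /= -mulrBr; congr (_ * _); lra.
Qed.

(** Increments of [g] are [h] times a convergent quotient, hence tend to 0; clamping at 0 is
    1-Lipschitz and carries this to the whole line. *)
Lemma continuous_extension g :
  (forall t, 0 <= t -> cvg (hl_quot g t @ hl_nbhs t)) ->
  continuous (fun s => g (Num.max s 0)).
Proof.
move=> gd x; set y := Num.max x 0.
have y0 : 0 <= y by rewrite le_max lexx orbT.
have /cvg_ex[/= l gl] := gd _ y0.
have : (fun h => h * hl_quot g y h) @ hl_nbhs y --> 0 * l.
  by apply: cvgM => //; exact: hl_nbhs_cvg0.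
rewrite mul0r => /cvgrPdist_le g0; apply/cvgrPdist_le => e e0.
have /nbhs_ballP[dl /= dl0 near0] := g0 _ e0.
apply/nbhs_ballP; exists dl => //= z; rewrite /ball/= => xz.
set u := Num.max z 0.
have yu : `|u - y| < dl.
  apply: le_lt_trans xz; rewrite /u /y !maxEle.
  have := ler_norm (x - z); have := ler_norm (z - x).
  rewrite (distrC z) ler_norml.
  by case: ifPn => zi; case: ifPn => xi; rewrite -?ltNge in zi xi; lra.
(* The punctured filter omits the increment 0, which clamping can produce. *)
have [uy|uy] := eqVneq (u - y) 0.
  by move/eqP: uy; rewrite subr_eq0 => /eqP ->; rewrite subrr normr0 ltW.
have := near0 (u - y); rewrite /ball/= sub0r normrN => /(_ yu uy).
rewrite /hl_quot subrKC mulVKf// sub0r normrN distrC; apply.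
by rewrite le_max lexx orbT.
Qed.

(* Extending [g] to the left by its value at 0 makes the two-sided fundamental
   theorem of calculus applicable at [t = 0]. *)
Lemma hl_quot_integral g :
  (forall t, 0 <= t -> cvg (hl_quot g t @ hl_nbhs t)) ->
  forall t, 0 <= t ->
  hl_quot (fun s => \int[lebesgue_measure]_(tau in `[0, s]) g tau) t
    @ hl_nbhs t --> g t.
Proof.
move=> gd t t0; pose k s := g (Num.max s 0).
have kc : continuous k by exact: continuous_extension.
have ki a b : lebesgue_measure.-integrable `[a, b] (EFin \o k).
  apply: continuous_compact_integrable; first exact: segment_compact.
  exact: continuous_subspaceT.
(* The base point -1 puts [t] in the interior even for [t = 0]; subtracting [I 0] moves the base
   point back to 0. *)
pose I s := \int[lebesgue_measure]_(tau in `[-1, s]) k tau.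
have Nt : -1 < t by rewrite (lt_le_trans _ t0)// ltrN10.
have [Id IE] : derivable I t 1 /\ derive1 I t = k t.
  apply: (@continuous_FTC1_closed R k (-1) t (t + 1)) => //.
    by rewrite ltrDl.
  exact: kc.
have gk s : 0 <= s -> k s = g s by move=> s0; rewrite /k max_l.
have : hl_quot (I \- cst (I 0)) t @ hl_nbhs t --> g t.
  rewrite -[g t]subr0 -gk// -IE.
  apply: hl_quotB; first exact: hl_quot_derivable.
  rewrite (_ : hl_quot _ t = cst 0); first exact: cvg_cst.
  by apply/funext => h; rewrite /hl_quot subrr mulr0.
apply: eq_hl_quot_cvg => // s s0 /=.
rewrite Rintegral_itvB ?bnd_simp ?lerN10//.
rewrite Rintegral_itv_obnd_cbnd; last first.
  by apply: integrableS (ki 0 s) => //; exact: subset_itv_oc_cc.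
by apply: eq_Rintegral => z; rewrite inE/= in_itv/= => /andP[z0 _]; exact: gk.
Qed.

End HalfLineCalculus.

(** * The time derivative evaluated at the minimizer *)

Section DriftAtMinimizer.
Context {R : realType} {d : nat}.
Variables (f : 'rV[R]_d -> R -> R) (G : R -> R) (m L2 : R).
Hypothesis m_gt0 : 0 < m.
Hypothesis f_C1 : C1_grad_x f.
Hypothesis f_tx : forall (x : 'rV[R]_d) (t : R),
  0 <= t -> enorm (grad_tx f x t) <= L2.
Hypothesis f_sc : forall (x : 'rV[R]_d) (t : R),
  0 <= t -> loewner_le m%:M (hess_xx f x t).
Hypothesis fbar_d1 : forall (x : 'rV[R]_d) (t : R), derivable (fbar f G x) t 1.
Hypothesis fbar_d2 : forall (x : 'rV[R]_d) (t : R),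
  derivable (derive1 (fbar f G x)) t 1.
Implicit Types (x v a : 'rV[R]_d) (t s : R).

Local Notation xs := (minimizer f).

(** The integrand of [fcheck]: the point is frozen at [xs t] while differentiating in time. *)
Definition drift t := derive1 (fbar f G (xs t)) t.

Lemma drift_dist x t : 0 <= t ->
  `|derive1 (fbar f G x) t - drift t| <= L2 / m * enorm (grad_x f x t).
Proof.
move=> t0; set v := x - xs t.
have L20 : 0 <= L2 := le_trans (enorm_ge0 _) (f_tx x t0).
apply: (@le_trans _ _ (L2 * enorm v)); last first.
  by rewrite -mulrA ler_wpM2l// ler_pdivlMl// minimizer_dist.
(* With reference vector 0 the increment estimate becomes a Lipschitz bound; the window 1 is
   arbitrary, as [L2] bounds all later times. *)
have := @derive1_fbar_increment R d f G f_C1 fbar_d1 (xs t) v 0 t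
  (L2 * enorm v) 1 ltr01.
rewrite dot0v subr0 subrKC; apply => sg ta _ /andP[ta0 _].
rewrite subr0; apply: le_trans (normr_dotv_le _ _) _.
by rewrite ler_wpM2r ?enorm_ge0// f_tx// (le_trans t0).
Qed.

(** A chain rule along the path: the quotient splits into a spatial increment [A] at time [t + h]
    and the time quotient at the fixed point [xs t]. *)
Lemma drift_quot_cvg t : 0 <= t ->
  let a := grad_tx f (xs t) t in
  let l := - a *m invmx (hess_xx f (xs t) t) in
  hl_quot drift t @ hl_nbhs t -->
    dotv a l + derive1 (derive1 (fbar f G (xs t))) t.
Proof.
move=> t0 a l; have W := hl_nbhs_proper t0.
pose q h := h^-1 *: (xs (t + h) - xs t).
pose A h := h^-1 * (derive1 (fbar f G (xs (t + h))) (t + h)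
                    - derive1 (fbar f G (xs t)) (t + h)).
have -> : hl_quot drift t = A \+ hl_quot (derive1 (fbar f G (xs t))) t.
  apply/funext => h; rewrite /A /hl_quot /= -mulrDr /drift.
  by congr (_ * _); lra.
apply: cvgD; last exact: hl_quot_derivable.
have ql : (fun h => dotv a (q h)) @ hl_nbhs t --> dotv a l.
  apply: cvg_dotv; first exact: cvg_cst.
  exact: (minimizer_derivative m_gt0 f_C1 f_tx f_sc).
suff Aq : (fun h => A h - dotv a (q h)) @ hl_nbhs t --> 0.
  rewrite -[dotv a l]add0r.
  rewrite (_ : A = fun h => (A h - dotv a (q h)) + dotv a (q h)).
    exact: cvgD.
  by apply/funext => h; rewrite subrK.
pose K := Num.max (L2 / m) 1.
have K1 : 1 <= K by rewrite /K le_max lexx orbT.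
have K0 : 0 < K := lt_le_trans ltr01 K1.
apply/cvgrPdist_le => e e0.
have eK0 : 0 < e / K by rewrite divr_gt0.
have /nbhs_ballP[dl /= dl0 near0] := near_grad_tx f_C1 (xs t) t eK0.
(* Half of [dl] covers the shift from [t] to [t + h], the other half the time window after it; [K]
   covers the motion of the minimizer. *)
apply: (@near_hl_nbhs _ _ _ (dl / (2 * K))).
  by rewrite divr_gt0// mulr_gt0.
move=> h h0; rewrite ltr_pdivlMr ?mulr_gt0// => hdl th0.
have hK : `|h| <= `|h| * K by rewrite ler_peMr.
set v := xs (t + h) - xs t.
have vK : enorm v <= K * `|h|.
  have := minimizer_lipschitz m_gt0 f_C1 f_tx f_sc t0 th0.
  rewrite addrAC subrr add0r => /le_trans; apply.
  by rewrite ler_wpM2r// /K le_max lexx.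
have -> : A h - dotv a (q h) = h^-1 * (derive1 (fbar f G (xs (t + h))) (t + h)
    - derive1 (fbar f G (xs t)) (t + h) - dotv a v).
  by rewrite /A /q dotvZr -mulrBr.
rewrite sub0r normrN normrM normfV ler_pdivrMl ?normr_gt0//.
have := @derive1_fbar_increment R d f G f_C1 fbar_d1 (xs t) v a (t + h)
  (`|h| * e) (dl / 2) (divr_gt0 dl0 (ltr0Sn _ _)).
rewrite subrKC; apply => sg ta /andP[sg0 sg1] /andP[ta1 ta2].
apply: le_trans (normr_dotv_le _ _) _.
have E1 : enorm (grad_tx f (xs t + sg *: v) ta - a) <= e / K.
  apply: (near0 (xs t + sg *: v, ta)); split => /=.
    rewrite -ball_normE /ball_/= opprD addrA subrr sub0r normrN normrZ.
    rewrite ger0_norm//.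
    apply: le_lt_trans (_ : enorm v < dl).
      apply: le_trans (norm_le_enorm v).
      by rewrite ler_piMl.
    by apply: le_lt_trans vK _; lra.
  rewrite /ball/= distrC.
  have := ler_norm h; have := ler_norm (- h); rewrite normrN => h1 h2.
  by rewrite ltr_norml; apply/andP; split; lra.
apply: le_trans (ler_pM (enorm_ge0 _) (enorm_ge0 _) E1 vK) _.
by rewrite mulrA divfK ?gt_eqF// mulrC.
Qed.

(** After Cauchy-Schwarz, the second factor is a limit of quotients that the Lipschitz bound keeps
    below [L2 / m]. *)
Lemma minimizer_derivative_le t : 0 <= t ->
  `|dotv (grad_tx f (xs t) t)
     (- grad_tx f (xs t) t *m invmx (hess_xx f (xs t) t))| <= L2 ^+ 2 / m.
Proof.
move=> t0; have W := hl_nbhs_proper t0.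
set a := grad_tx _ _ _; apply: le_trans (normr_dotv_le _ _) _.
rewrite expr2 -mulrA ler_pM ?enorm_ge0//; first exact: f_tx.
have cv := cvg_enorm (FE := hl_nbhs_filter t)
  (minimizer_derivative m_gt0 f_C1 f_tx f_sc t0).
apply: (closed_cvg (fun z => z <= L2 / m) _ _ _ cv); first exact: closed_le.
apply: (near_hl_nbhs ltr01) => h h0 _ th0.
rewrite enormZ normfV ler_pdivrMl ?normr_gt0// mulrC.
have := minimizer_lipschitz m_gt0 f_C1 f_tx f_sc t0 th0.
by rewrite addrAC subrr add0r.
Qed.

End DriftAtMinimizer.

(** * Derivatives of the corrected function *)

(** The terms subtracted depend on [t] alone and cancel in every difference quotient, at negative
    times as well. *)
Lemma grad_x_fcheck (R : realType) (d : nat) (f : 'rV[R]_d -> R -> R)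
  (G : R -> R) : grad_x (fcheck f G) = grad_x f.
Proof.
apply/funext => x; apply/funext => t; apply/rowP => i; rewrite !mxE.
rewrite /derive; set q := (fun _ : R => _); set q' := (fun _ : R => _).
suff -> : q = q' by []; apply/funext => h; rewrite /q /q' /=.
by congr (_ *: _); rewrite /fcheck /fbar; lra.
Qed.

Theorem proposition1 (R : realType) (d : nat) (f : 'rV[R]_d -> R -> R)
    (G : R -> R) (m L1 L2 L3 G2 : R)
    (m_gt0 : 0 < m)
    (f_C1 : C1_grad_x f)
    (f_xx : forall (x : 'rV[R]_d) (t : R),
      0 <= t -> opnorm (hess_xx f x t) <= L1)
    (f_tx : forall (x : 'rV[R]_d) (t : R),
      0 <= t -> enorm (grad_tx f x t) <= L2)
    (f_sc : forall (x : 'rV[R]_d) (t : R),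
      0 <= t -> loewner_le (m%:M) (hess_xx f x t))
    (fbar_d1 : forall (x : 'rV[R]_d) (t : R), derivable (fbar f G x) t 1)
    (fbar_d2 : forall (x : 'rV[R]_d) (t : R),
      derivable (derive1 (fbar f G x)) t 1)
    (fbar_t : forall (x : 'rV[R]_d) (t : R),
      0 <= t -> `|derive1 (fbar f G x) t| <= G2)
    (fbar_tt : forall (x : 'rV[R]_d) (t : R),
      0 <= t -> `|derive1 (derive1 (fbar f G x)) t| <= L3) :
  [/\ C1_grad_x (fcheck f G),
      forall (x : 'rV[R]_d) (t : R), 0 <= t ->
        [/\ opnorm (hess_xx (fcheck f G) x t) <= L1,
            enorm (grad_tx (fcheck f G) x t) <= L2
          & loewner_le (m%:M) (hess_xx (fcheck f G) x t)],
      forall (x : 'rV[R]_d) (t : R), 0 <= t ->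
        hl_derivable (fcheck f G x) t /\
        hl_derivable (hl_derive (fcheck f G x)) t
    & forall (x : 'rV[R]_d) (t : R), 0 <= t ->
        [/\ `|hl_derive (fcheck f G x) t| <= 2 * G2,
            `|hl_derive (hl_derive (fcheck f G x)) t| <= 2 * L3 + L2 ^+ 2 / m
          & `|hl_derive (fcheck f G x) t|
            - L2 / m * enorm (grad_x (fcheck f G) x t) <= 0]].
Proof.
have hessE x t : hess_xx (fcheck f G) x t = hess_xx f x t.
  rewrite /hess_xx /hess; congr ('J _ x); apply/funext => y.
  exact: (congr1 (fun g => g y t) (grad_x_fcheck f G)).
have gtxE x t : grad_tx (fcheck f G) x t = grad_tx f x t.
  by rewrite /grad_tx grad_x_fcheck.
have dq := drift_quot_cvg m_gt0 f_C1 f_tx f_sc fbar_d1 fbar_d2.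
have H1 x t : 0 <= t -> hl_derivable (fcheck f G x) t /\
    hl_derive (fcheck f G x) t = derive1 (fbar f G x) t - drift f G t.
  move=> t0; apply: hl_derive_cvg => //.
  apply: hl_quotB; first exact: hl_quot_derivable.
  apply: hl_quot_integral => // s s0.
  by apply/cvg_ex; eexists; exact: dq.
(* The first derivative is replaced by its formula from [H1], which holds on the half-line only. *)
have H2 x t (t0 : 0 <= t) := hl_derive_cvg t0 (eq_hl_quot_cvg
  (fun s s0 => esym (H1 x s s0).2) t0
  (hl_quotB (hl_quot_derivable (fbar_d2 x t)) (dq t t0))).
split => [|x t t0|x t t0|x t t0].
- split; last by rewrite grad_x_fcheck; case: f_C1.
  move=> x t; have [fd _] := f_C1.
  (* At fixed [t] the two functions differ by a constant, read off at the point 0. *)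
  have -> : fcheck f G ^~ t = (fun y => f y t - (f 0 t - fcheck f G 0 t)).
    by apply/funext => y; rewrite /fcheck /fbar; lra.
  exact: (@differentiableB _ _ _ (f ^~ t) (cst _)).
- by rewrite hessE gtxE; split; [exact: f_xx|exact: f_tx|exact: f_sc].
- by have [D1 _] := H1 x t t0; have [D2 _] := H2 x t t0.
have [_ E1] := H1 x t t0; have [_ E2] := H2 x t t0; split.
- rewrite E1 mulr_natl mulr2n; apply: le_trans (ler_normB _ _) _.
  by apply: lerD; exact: fbar_t.
- rewrite E2 mulr_natl mulr2n -addrA; apply: le_trans (ler_normB _ _) _.
  apply: lerD; first exact: fbar_tt.
  apply: le_trans (ler_normD _ _) _; rewrite [leRHS]addrC.
  by apply: lerD; [exact: (minimizer_derivative_le m_gt0)|exact: fbar_tt].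
- by rewrite E1 grad_x_fcheck subr_le0; exact: drift_dist.
Qed.
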